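(* Let $L,M$ be locales and let $f\colon L\to M$ be a map preserving arbitrary meets. Define $f_{\mathfrak c}^{\Rightarrow}\colon \mathfrak c L\to\mathfrak c M$ by $f_{\mathfrak c}^{\Rightarrow}(\mathfrak c(a))=\big(\mathrm{int}(f[\mathfrak o(a)])\big)^{\mathsf c}$ and $f_{\mathfrak c}^{\leftarrow}\colon \mathfrak c M\to\mathfrak c L$ by $f_{\mathfrak c}^{\leftarrow}(\mathfrak c(b))=\mathrm{cl}(f^{-1}[\mathfrak c(b)])$. Then $(f_{\mathfrak c}^{\leftarrow},f_{\mathfrak c}^{\Rightarrow})$ is an adjunction, i.e. $f_{\mathfrak c}^{\leftarrow}\dashv f_{\mathfrak c}^{\Rightarrow}$, if and only if $f$ is an open localic map.
   Context: A locale (= frame) is a complete lattice $L$ with $(\bigvee A)\wedge b=\bigvee\{a\wedge b\mid a\in A\}$ for all $A\subseteq L$, $b\in L$; it has a Heyting operation $\to$ with $a\wedge b\le c\iff a\le b\to c$. A frame homomorphism preserves all joins and all finite meets (including $0$ and $1$). A localic map $f\colon L\to M$ is a right adjoint of a frame homomorphism $M\to L$. For $a\in L$: $\mathfrak c(a)=\{x\in L\mid x\ge a\}$ (closed sublocale), $\mathfrak o(a)=\{x\in L\mid a\to x=x\}$ (open sublocale). Complements $(-)^{\mathsf c}$ are taken in the lattice of sublocales, so $\mathfrak c(a)^{\mathsf c}=\mathfrak o(a)$ and $\mathfrak o(a)^{\mathsf c}=\mathfrak c(a)$. $\mathfrak c L=\{\mathfrak c(a)\mid a\in L\}$, ordered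 by inclusion. For any subset $S\subseteq L$, $\mathrm{cl}\,S=\mathfrak c(\bigwedge S)$ and $\mathrm{int}\,S=\mathfrak o(\bigvee\{a\in L\mid \mathfrak o(a)\subseteq S\})$. A map $f\colon L\to M$ is open if for every $a\in L$ the image $f[\mathfrak o(a)]$ is an open sublocale of $M$; an open localic map is a localic map that is open. For posets $X,Y$ and order-preserving maps $g\colon X\to Y$, $h\colon Y\to X$, $(g,h)$ is an adjunction, $g\dashv h$, if $g(x)\le y\iff x\le h(y)$ for all $x\in X$, $y\in Y$. *)

(* Defs.v *)
From HB Require Import structures.
From mathcomp Require Import all_boot all_order.
From mathcomp Require Import boolp classical_sets.

Set Implicit Arguments.
Unset Strict Implicit.
Unset Printing Implicit Defensive.

Import Order.TTheory.
Local Open Scope classical_set_scope.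

HB.mixin Record TBLattice_isLocale d T of Order.TBLattice d T := {
  bigjoin : set T -> T;
  bigjoin_lub : forall A : set T, isLub A (bigjoin A);
  bigjoin_meetl : forall (A : set T) (b : T),
    Order.meet (bigjoin A) b = bigjoin [set Order.meet a b | a in A]
}.

#[short(type="localeType")]
HB.structure Definition Locale d :=
  {T of TBLattice_isLocale d T & Order.TBLattice d T}.

Section LocaleOps.
Context {d : Order.disp_t} {L : localeType d}.
Implicit Types (A S T : set L) (a b x y : L).

Definition bigmeet A : L := bigjoin (lbound A).

Definition heyting a b : L := bigjoin [set x | (Order.meet x a <= b)%O].

Lemma bigmeet_lb A x : A x -> (bigmeet A <= x)%O.
Proof. by move=> Ax; apply: (bigjoin_lub _).2 => y; apply. Qed.

Lemma bigmeet_glb A y : lbound A y -> (y <= bigmeet A)%O.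
Proof. by move=> yA; apply: (bigjoin_lub _).1. Qed.

Lemma heytingP a b c : (Order.meet a b <= c)%O = (a <= heyting b c)%O.
Proof.
apply/idP/idP => [abc|abc]; first exact: (bigjoin_lub _).1.
apply: le_trans (leI2 abc (lexx b)) _.
by rewrite /heyting bigjoin_meetl; apply: (bigjoin_lub _).2 => _ [x + <-].
Qed.

Definition is_sublocale S :=
  (forall A, A `<=` S -> S (bigmeet A)) /\
  (forall x s, S s -> S (heyting x s)).

Definition closed_sub a : set L := [set x | (a <= x)%O].

Definition open_sub a : set L := [set x | heyting a x = x].

(* In the lattice of sublocales ordered by inclusion, the meet is the
   intersection, the bottom is [set \top] and the top is setT. *)
Definition sublocale_join S T : set L := smallest is_sublocale (S `|` T).

Definition sublocale_complement S T :=
  [/\ is_sublocale S, is_sublocale T, S `&` T = [set \top%O]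
    & sublocale_join S T = setT].

(* The complement of a complemented sublocale; its value on any other set is
   irrelevant. *)
Definition compl S : set L := xget set0 [set T | sublocale_complement S T].

Definition cl S : set L := closed_sub (bigmeet S).

Definition interior_sub S : set L :=
  open_sub (bigjoin [set a | open_sub a `<=` S]).

Lemma heytingxx a : heyting a a = \top%O.
Proof. by apply/le_anti; rewrite lex1 /= -heytingP leIr. Qed.

Lemma heyting_top a x : (heyting a x = \top%O) <-> (a <= x)%O.
Proof.
split=> [ax|ax]; last by apply/le_anti; rewrite lex1 /= -heytingP meet1x.
by rewrite -[a]meet1x heytingP ax.
Qed.

Lemma le_heyting a x : (x <= heyting a x)%O.
Proof. by rewrite -heytingP leIl. Qed.

Lemma le_open x a : (heyting a x <= x)%O -> open_sub a x.
Proof. by move=> h; apply/le_anti; rewrite h le_heyting. Qed.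

Lemma heyting_mp a x : (Order.meet (heyting a x) a <= x)%O.
Proof. by rewrite heytingP. Qed.

Lemma is_sublocale_closed a : is_sublocale (closed_sub a).
Proof.
split=> [A Aa|x s as_]; first by apply: bigmeet_glb => x /Aa.
exact: le_trans as_ (le_heyting _ _).
Qed.

Lemma is_sublocale_open a : is_sublocale (open_sub a).
Proof.
split=> [A Aa|x s as_]; apply: le_open.
  apply: bigmeet_glb => x Ax; rewrite -(Aa _ Ax) -heytingP.
  exact: le_trans (heyting_mp _ _) (bigmeet_lb Ax).
rewrite -heytingP -[X in (_ <= X)%O]as_ -heytingP meetAC heytingP.
exact: heyting_mp.
Qed.

Definition join_fix S T : set L :=
  [set z | exists s t, [/\ S s, T t & z = Order.meet s t]].

Lemma heytingI x s t :
  heyting x (Order.meet s t) = Order.meet (heyting x s) (heyting x t).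
Proof.
apply/le_anti/andP; split.
  by rewrite lexI -!heytingP; apply/andP; split;
    apply: le_trans (heyting_mp _ _) _; rewrite ?leIl ?leIr.
by rewrite -heytingP lexI; apply/andP; split; rewrite heytingP ?leIl ?leIr.
Qed.

Lemma sublocale_top S : is_sublocale S -> S \top%O.
Proof.
case=> Sm _; have -> : \top%O = bigmeet set0 :> L by
  apply/le_anti; rewrite lex1 andbT; apply: bigmeet_glb => ? [].
by apply: Sm; exact: sub0set.
Qed.

Lemma sublocale_joinE S T : is_sublocale S -> is_sublocale T ->
  sublocale_join S T = join_fix S T.
Proof.
move=> Ss Ts; apply/seteqP; split; last first.
  move=> _ [s [t [Ss' Tt ->]]] U [[Um _] STU].
  have -> : Order.meet s t = bigmeet [set s; t].
    apply/le_anti/andP; split.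
      by apply: bigmeet_glb => x [->|->]; rewrite ?leIl ?leIr.
    by rewrite lexI !bigmeet_lb //=; [right|left].
  by apply: Um => x [->|->]; apply: STU; [left|right].
apply: smallest_sub; last first.
  move=> x [Sx|Tx]; [exists x, \top%O|exists \top%O, x]; split => //.
  - exact: sublocale_top.
  - by rewrite meetx1.
  - exact: sublocale_top.
  - by rewrite meet1x.
split=> [A AST|x _ [s [t [Ss' Tt ->]]]]; last first.
  exists (heyting x s), (heyting x t); split; last exact: heytingI.
    exact: Ss.2.
  exact: Ts.2.
pose A1 := [set s | S s /\ exists z, A z /\ (z <= s)%O].
pose A2 := [set s | T s /\ exists z, A z /\ (z <= s)%O].
exists (bigmeet A1), (bigmeet A2); split.
- by apply: Ss.1 => s [].
- by apply: Ts.1 => s [].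
apply/le_anti/andP; split.
  rewrite lexI; apply/andP; split; apply: bigmeet_glb => s [_ [z [Az zs]]];
    exact: le_trans (bigmeet_lb Az) zs.
apply: bigmeet_glb => z Az; have [s [t [Ss' Tt E]]] := AST _ Az.
rewrite E; apply: leI2; apply: bigmeet_lb; split=> //; exists z; split=> //;
  by rewrite E ?leIl ?leIr.
Qed.

Lemma open_meet_closed a : open_sub a `&` closed_sub a = [set \top%O].
Proof.
apply/seteqP; split=> [x [ax /heyting_top]|_ ->]; first by rewrite ax.
by split; [exact: (sublocale_top (is_sublocale_open a))|exact: lex1].
Qed.

Lemma open_join_closed a : join_fix (open_sub a) (closed_sub a) = setT.
Proof.
apply/seteqP; split=> // x _.
exists (heyting a x), (Order.join a x); split.
- by apply: le_open; rewrite -!heytingP; apply: le_trans (heyting_mp a x);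
    rewrite lexI leIr andbT; apply: heyting_mp.
- exact: leUl.
- apply/le_anti; rewrite lexI le_heyting leUr /=.
  rewrite meetC heytingP leUx le_heyting andbT.
  by rewrite -heytingP meetC heyting_mp.
Qed.

Lemma join_fixC S T : join_fix S T = join_fix T S.
Proof.
by apply/seteqP; split=> _ [s [t [? ? ->]]]; exists t, s; rewrite meetC.
Qed.

Lemma compl_openP a : sublocale_complement (open_sub a) (closed_sub a).
Proof.
have [o c] := (is_sublocale_open a, is_sublocale_closed a).
by split=> //; rewrite ?open_meet_closed // sublocale_joinE // open_join_closed.
Qed.

Lemma compl_closedP a : sublocale_complement (closed_sub a) (open_sub a).
Proof.
have [o c] := (is_sublocale_open a, is_sublocale_closed a).
split=> //; first by rewrite setIC open_meet_closed.
by rewrite sublocale_joinE // join_fixC open_join_closed.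
Qed.

Lemma compl_open a : compl (open_sub a) = closed_sub a.
Proof.
rewrite /compl; case: xgetP => [T _ [o Ts oT1 oTT]|/(_ _ (compl_openP a))//].
apply/seteqP; split=> x.
  move=> Tx; apply/heyting_top.
  have : (open_sub a `&` T) (heyting a x).
    split; last exact: Ts.2.
    by apply: le_open; rewrite -heytingP; apply: le_trans (heyting_mp a x);
      rewrite lexI leIr andbT; apply: heyting_mp.
  by rewrite oT1.
move=> ax; have : sublocale_join (open_sub a) T x by rewrite oTT.
rewrite sublocale_joinE // => -[s [t [as_ Tt E]]].
suff s1 : s = \top%O by rewrite E s1 meet1x.
rewrite -as_; apply/heyting_top; apply: le_trans ax _.
by rewrite E leIl.
Qed.

Lemma compl_closed a : compl (closed_sub a) = open_sub a.
Proof.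
rewrite /compl; case: xgetP => [T _ [c Ts cT1 cTT]|/(_ _ (compl_closedP a))//].
apply/seteqP; split=> x.
  move=> Tx; apply/le_open/heyting_top.
  have : (closed_sub a `&` T) (heyting (heyting a x) x).
    split; last exact: Ts.2.
    by rewrite /closed_sub /= -heytingP meetC heyting_mp.
  by rewrite cT1.
move=> ax; have : sublocale_join (closed_sub a) T x by rewrite cTT.
rewrite sublocale_joinE // => -[s [t [/heyting_top as_ Tt E]]].
by rewrite -ax E heytingI as_ meet1x; apply: Ts.2.
Qed.

Definition closed_sublocales : set (set L) := range closed_sub.

Lemma closed_subP a : closed_sub a \in closed_sublocales.
Proof. by rewrite inE; exists a. Qed.

Lemma bigmeet_closed a : bigmeet (closed_sub a) = a.
Proof.
apply/le_anti/andP; split; last by apply: bigmeet_glb.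
by apply: bigmeet_lb; exact: lexx.
Qed.

End LocaleOps.

Record closedSublocale d (L : localeType d) := ClosedSublocale {
  closedSublocale_set :> set L;
  _ : closedSublocale_set \in @closed_sublocales d L
}.

Section ClosedSublocaleOrder.
Context {d : Order.disp_t} (L : localeType d).

HB.instance Definition _ := [isSub for @closedSublocale_set d L].
HB.instance Definition _ := [Choice of closedSublocale L by <:].
(* The order on [set L] is inclusion. *)
HB.instance Definition _ := [SubChoice_isSubPOrder of closedSublocale L by <:
  with set_display].

Definition cc (a : L) : closedSublocale L := ClosedSublocale (closed_subP a).

Lemma le_closedSublocaleE (C D : closedSublocale L) :
  (C <= D)%O <-> (C : set L) `<=` D.
Proof. by rewrite -Order.le_val /=; split=> /asboolP. Qed.

End ClosedSublocaleOrder.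

Section Maps.
Context {dL dM : Order.disp_t} {L : localeType dL} {M : localeType dM}.

Definition preserves_meets (f : L -> M) :=
  forall A : set L, f (bigmeet A) = bigmeet (f @` A).

Definition frame_hom (h : M -> L) :=
  [/\ forall A : set M, h (bigjoin A) = bigjoin (h @` A),
      {morph h : x y / Order.meet x y >-> Order.meet x y},
      h \bot%O = \bot%O
    & h \top%O = \top%O].

Definition open_map (f : L -> M) :=
  forall a : L, exists b : M, f @` open_sub a = open_sub b.

Lemma fc_right_subproof (f : L -> M) (C : closedSublocale L) :
  compl (interior_sub (f @` open_sub (bigmeet C))) \in closed_sublocales.
Proof. by rewrite compl_open closed_subP. Qed.

(* The element a with C = closed_sub a is bigmeet C; see fc_rightE and
   fc_leftE for the action on closed_sub a. *)
Definition fc_right (f : L -> M) (C : closedSublocale L) : closedSublocale M :=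
  ClosedSublocale (fc_right_subproof f C).

Definition fc_left (f : L -> M) (D : closedSublocale M) : closedSublocale L :=
  ClosedSublocale (closed_subP (bigmeet (f @^-1` D))).

Lemma fc_rightE (f : L -> M) (a : L) :
  fc_right f (cc a) = compl (interior_sub (f @` open_sub a)) :> set M.
Proof. by rewrite /= bigmeet_closed. Qed.

Lemma fc_leftE (f : L -> M) (b : M) :
  fc_left f (cc b) = cl (f @^-1` closed_sub b) :> set L.
Proof. by []. Qed.

End Maps.

Definition adjunction dX dY (X : porderType dX) (Y : porderType dY)
    (g : X -> Y) (h : Y -> X) :=
  [/\ {homo g : x y / (x <= y)%O}, {homo h : x y / (x <= y)%O}
    & forall x y, (g x <= y)%O <-> (x <= h y)%O].

Definition localic_map dL dM (L : localeType dL) (M : localeType dM)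
    (f : L -> M) :=
  exists h : M -> L, frame_hom h /\ adjunction h f.

Definition open_localic_map dL dM (L : localeType dL) (M : localeType dM)
    (f : L -> M) :=
  localic_map f /\ open_map f.

(* Main.v *)
Require Import Defs.
From HB Require Import structures.
From mathcomp Require Import all_boot all_order.
From mathcomp Require Import boolp classical_sets.

(** Let [h] be the left adjoint of [f] and let [phi a] be the largest [m] with
    [o(m)] contained in [f[o(a)]]. Then the two maps of the statement act by
    [c(b) |-> c(h b)] and [c(a) |-> c(phi a)], so their adjunction means that
    [phi] is left adjoint to [h]. In that case [h] preserves meets, and Frobenius
    reciprocity gives [f[o(a)] = o(phi a)]. Conversely, if [f] is localic and
    [f[o(a)] = o(b)], then [b = phi a], and [b <= m] says that [c(m)] meets
    [f[o(a)]] trivially, i.e. that [c(h m)] meets [o(a)] trivially, i.e. that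
    [a <= h m]. *)

Set Implicit Arguments.
Unset Strict Implicit.
Unset Printing Implicit Defensive.

Import Order.TTheory.
Local Open Scope classical_set_scope.

Section Locale.
Context {d : Order.disp_t} {L : localeType d}.
Implicit Types (A S : set L) (a b x : L).

Lemma bigjoin_ub A x : A x -> (x <= bigjoin A)%O.
Proof. exact: (bigjoin_lub A).1. Qed.

Lemma bigjoin_le A x : (bigjoin A <= x)%O <-> ubound A x.
Proof.
split=> [Ax y Ay|]; last exact: (bigjoin_lub A).2.
exact: le_trans (bigjoin_ub Ay) Ax.
Qed.

Lemma bigjoin0 : bigjoin set0 = \bot%O :> L.
Proof. by apply/le_anti; rewrite le0x andbT; apply/bigjoin_le => ? []. Qed.

Lemma open_sub_heyting a x : open_sub a (heyting a x).
Proof.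
apply: le_open; rewrite -heytingP; apply: le_trans (heyting_mp a x).
by rewrite lexI leIr andbT heyting_mp.
Qed.

(** To bound [y] by a point of [o(a)], one may first cut [y] down by [a]. *)
Lemma open_sub_le a x y : open_sub a x -> (Order.meet y a <= x)%O -> (y <= x)%O.
Proof. by move=> ax; rewrite heytingP ax. Qed.

Lemma open_sub_sub a b : (a <= b)%O -> open_sub a `<=` open_sub b.
Proof.
move=> ab x ax; apply/le_open/(open_sub_le ax).
by apply: le_trans (heyting_mp b x); apply: leI2.
Qed.

(** The test point is [heyting a b]: it lies in [o(a)] and above [b], so triviality of the
    intersection makes it the top. *)
Lemma le_open_closed_disjoint a b :
  (a <= b)%O <-> (forall x, open_sub a x -> (b <= x)%O -> x = \top%O).
Proof.
split=> [ab x ax bx|H].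
  by rewrite -ax; apply/heyting_top/(le_trans ab).
by apply/heyting_top/H; [exact: open_sub_heyting|exact: le_heyting].
Qed.

Lemma open_sub_leP a b : open_sub a `<=` open_sub b <-> (a <= b)%O.
Proof.
split=> [ab|]; last exact: open_sub_sub.
by apply/le_open_closed_disjoint => x /ab bx /heyting_top; rewrite bx.
Qed.

(* [o] sends joins to joins: [x = \/A -> x] is the meet of the [a -> x]. *)
Lemma open_sub_bigjoin A S : (forall B, B `<=` S -> S (bigmeet B)) ->
  (forall a, A a -> open_sub a `<=` S) -> open_sub (bigjoin A) `<=` S.
Proof.
move=> Sm AS x Ax.
have -> : x = bigmeet [set heyting a x | a in A].
  apply/le_anti/andP; split.
    by apply: bigmeet_glb => _ [a _ <-]; exact: le_heyting.
  apply: (open_sub_le Ax); rewrite meetC heytingP; apply/bigjoin_le => a Aa.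
  rewrite -heytingP meetC heytingP.
  by apply: bigmeet_lb; exists a.
by apply: Sm => _ [a Aa <-]; apply: (AS a Aa); exact: open_sub_heyting.
Qed.

Lemma le_cc a b : (cc a <= cc b)%O <-> (b <= a)%O.
Proof.
rewrite le_closedSublocaleE; split=> [|ba x]; last exact: le_trans.
by apply; exact: lexx.
Qed.

Lemma ccP (C : closedSublocale L) : exists a, C = cc a.
Proof.
case: C => C CP; have /set_mem [a _ Ca] := CP.
by exists a; apply: val_inj.
Qed.

End Locale.

Section MeetPreserving.
Context {dL dM : Order.disp_t} {L : localeType dL} {M : localeType dM}.
Variable f : L -> M.

Definition left_adj (b : M) : L := bigmeet (f @^-1` closed_sub b).

Definition open_image (a : L) : M :=
  bigjoin [set m | open_sub m `<=` f @` open_sub a].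

Lemma fc_left_cc b : fc_left f (cc b) = cc (left_adj b).
Proof. by []. Qed.

Lemma fc_right_cc a : fc_right f (cc a) = cc (open_image a).
Proof. by apply: val_inj; rewrite /= bigmeet_closed compl_open. Qed.

Lemma open_image_homo : {homo open_image : a b / (a <= b)%O}.
Proof.
move=> a b ab; apply/bigjoin_le => m ma; apply: bigjoin_ub => y /ma [x ax <-].
by exists x => //; exact: open_sub_sub ab _ ax.
Qed.

(** Since [o] is an order embedding, the largest [m] with [o(m)] inside [o(b)] is [b] itself. *)
Lemma open_imageE a b : f @` open_sub a = open_sub b -> open_image a = b.
Proof.
rewrite /open_image => ->; apply/le_anti/andP; split; last exact: bigjoin_ub.
by apply/bigjoin_le => m /open_sub_leP.
Qed.

Hypothesis hf : preserves_meets f.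

Lemma meet_homo : {homo f : x y / (x <= y)%O}.
Proof.
move=> x y xy; have -> : x = bigmeet [set x; y].
  apply/le_anti/andP; split; first by apply: bigmeet_glb => _ [->|->].
  by apply: bigmeet_lb; left.
by rewrite hf; apply: bigmeet_lb; exists y => //; right.
Qed.

Lemma left_adjP b x : (left_adj b <= x)%O <-> (b <= f x)%O.
Proof.
split=> [|bx]; last exact: bigmeet_lb.
by move=> /meet_homo; apply: le_trans; rewrite hf; apply: bigmeet_glb => _ [y ? <-].
Qed.

Lemma left_adj_homo : {homo left_adj : b c / (b <= c)%O}.
Proof. by move=> b c bc; apply/left_adjP/(le_trans bc)/left_adjP. Qed.

Lemma left_adj_bigjoin A : left_adj (bigjoin A) = bigjoin (left_adj @` A).
Proof.
apply/le_anti/andP; split.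
  apply/left_adjP/bigjoin_le => b Ab; apply/left_adjP.
  by apply: bigjoin_ub; exists b.
by apply/bigjoin_le => _ [b Ab <-]; apply: left_adj_homo; exact: bigjoin_ub.
Qed.

(** Every closed sublocale is some [cc a], and [cc] reverses the order, so the two adjoints exchange
    sides. *)
Lemma fc_adjunctionP : adjunction (fc_left f) (fc_right f) <->
  (forall a b, (open_image a <= b)%O <-> (a <= left_adj b)%O).
Proof.
split=> [[_ _ H] a b|H].
  by have := H (cc b) (cc a); rewrite fc_left_cc fc_right_cc !le_cc => ->.
split=> C D; have [c ->] := ccP C; have [e ->] := ccP D.
- by rewrite !fc_left_cc !le_cc; exact: left_adj_homo.
- by rewrite !fc_right_cc !le_cc; exact: open_image_homo.
- by rewrite fc_left_cc fc_right_cc !le_cc H.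
Qed.

(** The supremum defining [open_image a] is attained, because [f[o(a)]] is closed under meets. *)
Lemma open_image_sub a : open_sub (open_image a) `<=` f @` open_sub a.
Proof.
apply: open_sub_bigjoin => // B Ba.
(* A subset [B] of the image is the image of its preimage in [o(a)], whose meet [f] preserves. *)
exists (bigmeet (open_sub a `&` f @^-1` B)).
  by apply: (is_sublocale_open a).1 => x [].
by rewrite hf; congr bigmeet; apply/seteqP; split=> [_ [x [_ Bx] <-]//|y By];
  have [x ax xy] := Ba _ By; exists x => //; split=> //=; rewrite xy.
Qed.

Section OpenImageAdjoint.
Hypothesis adj : forall a b, (open_image a <= b)%O <-> (a <= left_adj b)%O.

(** Joins are preserved by a left adjoint of [f], finite meets by a right adjoint of
    [open_image]. *)
Lemma left_adj_frame_hom : frame_hom left_adj.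
Proof.
split=> [|b c||].
- exact: left_adj_bigjoin.
- apply/le_anti/andP; split.
    by rewrite lexI !left_adj_homo ?leIl ?leIr.
  by apply/adj; rewrite lexI; apply/andP; split; apply/adj; rewrite ?leIl ?leIr.
- by rewrite -bigjoin0 left_adj_bigjoin image_set0 bigjoin0.
- by apply/le_anti; rewrite lex1 /=; apply/adj; exact: lex1.
Qed.

Lemma open_map_adj : open_map f.
Proof.
move=> a; exists (open_image a); apply/seteqP; split; last exact: open_image_sub.
(* With [h] for [left_adj] and [p] for [open_image a], it remains to bound [h (p -> f x)] met with
   [a] by [x]. The unit [a <= h p] and preservation of meets reduce this to modus ponens transposed
   along [h]. *)
move=> _ [x ax <-]; apply/le_open/left_adjP/(open_sub_le ax).
have [_ hI _ _] := left_adj_frame_hom.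
have /left_adjP := heyting_mp (open_image a) (f x).
by rewrite hI; apply: le_trans; apply: leI2 => //; apply/adj.
Qed.

End OpenImageAdjoint.

Lemma open_localic_adj : open_localic_map f ->
  forall a b, (open_image a <= b)%O <-> (a <= left_adj b)%O.
Proof.
case=> -[h [[_ _ _ h1] hadj]] fo a m; have [b ab] := fo a.
rewrite (open_imageE ab) !le_open_closed_disjoint -ab; split=> H.
  (* The point [f x] of the image lies above [m], so it is the top; transposing gives [h \top <= x],
     where [h \top] is the top. *)
  move=> x ax /left_adjP mx; apply/le_anti; rewrite lex1 -h1.
  by case: hadj => _ _ hP; apply/hP; rewrite (H (f x)).
move=> _ [x ax <-] /left_adjP mx; rewrite (H x ax mx).
by apply/le_anti; rewrite lex1 /=; apply/left_adjP; exact: lex1.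
Qed.

End MeetPreserving.

Theorem theorem3p4p3 (dL dM : Order.disp_t) (L : localeType dL)
    (M : localeType dM) (f : L -> M) (hf : preserves_meets f) :
  adjunction (fc_left f) (fc_right f) <-> open_localic_map f.
Proof.
rewrite (fc_adjunctionP hf); split=> [adj|]; last exact: open_localic_adj.
split; last exact: open_map_adj.
exists (left_adj f); split; first exact: left_adj_frame_hom.
split; [exact: left_adj_homo|exact: meet_homo|exact: left_adjP].
Qed.
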